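(* Let $F_1$ and $F_2$ be two $2$-SAT formulae on (subsets of) the $n$ Boolean variables of $F(n,p)$. Suppose that $F_1$ and $F_2$ have the same number of clauses and the same number of underlying variables, and that every underlying variable of $F_1$ is of type at least $(1,1)$ in $F_1$ and every underlying variable of $F_2$ is of type at least $(1,1)$ in $F_2$. Then $F_1$ and $F_2$ are equally likely to be the core of $F(n,p)$, i.e. $\Pr[F_C(n,p)=F_1]=\Pr[F_C(n,p)=F_2]$.
   Context: There are $n$ Boolean variables and $2n$ literals (each variable $x$ and its negation $\bar x$). A ($2$-)clause is a disjunction $(y\vee z)$ of two strictly distinct literals, meaning literals with different underlying variables; there are $2^2\binom n2$ possible clauses. A $2$-SAT formula is a conjunction (set) of clauses; its underlying variables are the variables $x$ such that $x$ or $\bar x$ occurs in some clause. The random formula $F(n,p)$ is the conjunction of clauses obtained by selecting each of the $2^2\binom n2$ possible clauses with probability $p$, independently of all others. A literal is pure in a formula if it belongs to at least one clause of the formula while its negation belongs to no clause. The pure literal algorithm (PLA) repeatedly selects a pure literal, sets it true, and removes all clauses containing it, until no pure literal is left. The formula $F_C(n,p)$ left after the PLA applied to $F(n,p)$ stops is called the core of $F(n,p)$. A variable $x$ is of type $(i,j)$ in a formula if $x$ appears in exactly $i$ clauses and $\bar x$ appears in exactly $j$ clauses of the formula; type at least $(1,1)$ means $i\ge 1$ and $j\ge 1$. *)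

(* Defs.v *)
From mathcomp Require Import all_boot all_order all_algebra.

Set Implicit Arguments.
Unset Strict Implicit.
Unset Printing Implicit Defensive.

Import Order.TTheory GRing.Theory Num.Theory.

(* The literal (x, true) is x and (x, false) is its negation. *)
Definition literal (n : nat) : finType := ('I_n * bool)%type.

Definition neg n (l : literal n) : literal n := (l.1, ~~ l.2).

(* A disjunction is unordered, so it is the set of its two literals. *)
Definition is_clause n (c : {set literal n}) : bool :=
  [exists y : literal n, exists z : literal n,
     (y.1 != z.1) && (c == [set y; z])].

Definition clause (n : nat) : finType := {c : {set literal n} | is_clause c}.

Definition formula (n : nat) : finType := {set clause n}.

Section Formulae.
Variable n : nat.
Implicit Types (F G C : formula n) (l : literal n) (x : 'I_n).

Definition clauses_with F l : formula n := [set c in F | l \in val c].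

Definition nocc F l : nat := #|clauses_with F l|.

Definition vars F : {set 'I_n} :=
  [set x | (0 < nocc F (x, true)) || (0 < nocc F (x, false))].

Definition var_type F x : nat * nat := (nocc F (x, true), nocc F (x, false)).

Definition type_at_least F x (i j : nat) : bool :=
  (i <= (var_type F x).1) && (j <= (var_type F x).2).

Definition pure F l : bool := (0 < nocc F l) && (nocc F (neg l) == 0).

Definition pla_move : rel (formula n) :=
  fun F G => [exists l, pure F l && (G == F :\: clauses_with F l)].

(* [connect] is the reflexive transitive closure: C can be left by some run
   of the algorithm on F, whatever pure literals that run selects. *)
Definition pla_output F C : bool :=
  connect pla_move F C && ~~ [exists l, pure C l].

Definition pla_step F : formula n :=
  if [pick l | pure F l] is Some l then F :\: clauses_with F l else F.

(* Every effective step removes a clause, so #|F| steps suffice; by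
   [pla_outputE] below, the choices made by [pick] are irrelevant. *)
Definition core F : formula n := iter #|F| pla_step F.

Lemma pla_move_sub F G : pla_move F G -> G \subset F.
Proof. by case/existsP=> l /andP[_ /eqP->]; apply: subsetDl. Qed.

Lemma pla_connect_sub F G : connect pla_move F G -> G \subset F.
Proof.
case/connectP=> p; elim: p F => [|H p IH] F /=; first by move=> _ ->.
case/andP=> /pla_move_sub sHF /IH{}IH /IH sGH; exact: subset_trans sGH sHF.
Qed.

Lemma nocc_sub F G l : G \subset F -> nocc G l <= nocc F l.
Proof.
move=> sGF; apply: subset_leq_card; apply/subsetP=> c; rewrite !inE.
by case/andP=> /(subsetP sGF)-> ->.
Qed.

Lemma pla_move_stable F G C : ~~ [exists l, pure C l] ->
  C \subset F -> pla_move F G -> C \subset G.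
Proof.
move=> /existsPn nC sCF /existsP[l /andP[/andP[_ nl0] /eqP->]].
apply/subsetP=> c cC; rewrite !inE (subsetP sCF _ cC) andbT /=.
apply: contra (nC l) => lc; apply/andP; split.
  by apply/card_gt0P; exists c; rewrite inE cC.
by rewrite -leqn0 -(eqP nl0) nocc_sub.
Qed.

Lemma pla_connect_stable F G C : ~~ [exists l, pure C l] ->
  C \subset F -> connect pla_move F G -> C \subset G.
Proof.
move=> nC sCF /connectP[p]; elim: p F sCF => [|H p IH] F sCF /=.
  by move=> _ ->.
by case/andP=> /(pla_move_stable nC sCF)/IH{}IH /IH.
Qed.

Lemma pla_output_uniq F C C' : pla_output F C -> pla_output F C' -> C = C'.
Proof.
case/andP=> cC nC /andP[cC' nC']; apply/eqP; rewrite eqEsubset.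
apply/andP; split; first exact: pla_connect_stable nC (pla_connect_sub cC) cC'.
exact: pla_connect_stable nC' (pla_connect_sub cC') cC.
Qed.

Lemma iter_pla_step_output k F : #|F| <= k -> pla_output F (iter k pla_step F).
Proof.
elim: k F => [|k IH] F.
  rewrite leqn0 cards_eq0 => /eqP-> /=; rewrite /pla_output connect0.
  apply/existsPn=> l; rewrite /pure /nocc.
  have -> : clauses_with set0 l = set0 by apply/setP=> c; rewrite !inE.
  by rewrite cards0.
rewrite iterSr {2}/pla_step; case: pickP => [l pl | np] leFk.
  have mv : pla_move F (F :\: clauses_with F l).
    by apply/existsP; exists l; rewrite pl eqxx.
  have /andP[cn st] : pla_output (F :\: clauses_with F l)
      (iter k pla_step (F :\: clauses_with F l)).
    apply: IH; rewrite cardsD -ltnS; apply: leq_trans leFk.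
    have sub : clauses_with F l \subset F by apply/subsetP=> c /[!inE] /andP[].
    rewrite (setIidPr sub) ltn_subrL; case/andP: pl => pl _; rewrite pl /=.
    exact: leq_trans pl (subset_leq_card sub).
  by rewrite /pla_output st (connect_trans (connect1 mv) cn).
have -> : iter k pla_step F = F.
  elim: k {IH leFk} => //= k ->; rewrite /pla_step.
  by case: pickP => // l; rewrite np.
by rewrite /pla_output connect0; apply/existsPn=> l; rewrite np.
Qed.

Lemma pla_outputE F C : pla_output F C = (C == core F).
Proof.
have cF : pla_output F (core F) by apply: iter_pla_step_output.
by apply/idP/eqP=> [/pla_output_uniq/(_ cF) | ->].
Qed.

End Formulae.

Section RandomFormula.
Local Open Scope ring_scope.
Variables (R : realFieldType) (n : nat) (p : R).

Definition rf_weight (F : formula n) : R :=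
  \prod_(c : clause n) (if c \in F then p else 1 - p).

(* [Pr_subset] is the joint law of independent selections of probability p. *)
Definition Pr (E : pred (formula n)) : R := \sum_(F | E F) rf_weight F.

Lemma Pr_subset (S : formula n) : Pr (fun F => S \subset F) = p ^+ #|S|.
Proof.
have -> : p ^+ #|S| = \prod_(c : clause n) (p + (if c \in S then 0 else 1 - p)).
  rewrite (bigID (mem S)) /= [X in _ * X]big1 ?mulr1 => [|c /negbTE->].
    by rewrite -prodr_const; apply: eq_bigr => c ->; rewrite addr0.
  by rewrite addrC subrK.
rewrite bigA_distr /Pr big_mkcond; apply: eq_bigr => F _.
case: ifPn => [sSF | /subsetPn[c cS cF]].
  apply: eq_bigr => c _; case: ifPn => // cF.
  by case: ifPn => // cS; rewrite (subsetP sSF) in cF.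
by rewrite (bigD1 c) //= (negbTE cF) cS mul0r.
Qed.

Lemma Pr_setT : Pr predT = 1.
Proof.
rewrite -[RHS](expr0 p) -(cards0 (clause n)) -Pr_subset.
by apply: eq_bigl => F; rewrite sub0set.
Qed.

End RandomFormula.

(* Main.v *)
(** Write [V] for the common set of variables (after renaming). Since both
    literals of every variable of [V] occur in [F1], adding to [F1] any clauses
    over [V] creates no pure literal; hence a formula with core [F1] has exactly
    the clauses of [F1] as its clauses over [V]. For a set [G] of clauses not
    contained in [V], whether [F1 :|: G] has a pure literal depends on [F1] only
    through [V], so [F1 :|: G] has core [F1] iff [F2 :|: G] has core [F2].
    Exchanging [F1] for [F2] is thus a bijection preserving the number of
    clauses, and so the probability. *)
Require Import Defs.
From mathcomp Require Import all_boot all_order all_algebra fingroup perm.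

Set Implicit Arguments.
Unset Strict Implicit.
Unset Printing Implicit Defensive.

Import Order.TTheory GRing.Theory Num.Theory.
Local Open Scope ring_scope.

(** List [T] twice, once with [A] first and once with [B] first; matching the lists by position is a
    permutation, and equal cardinals make the two initial blocks correspond. *)
Lemma perm_imset_eq_card (T : finType) (A B : {set T}) :
  #|A| = #|B| -> exists s : {perm T}, s @: A = B.
Proof.
move=> eqAB; pose e (C : {set T}) := enum C ++ enum (~: C).
have mem_e C x : x \in e C by rewrite mem_cat !mem_enum inE orbN.
have uniq_e C : uniq (e C).
  rewrite cat_uniq !enum_uniq andbT; apply/hasPn => x.
  by rewrite /= !mem_enum inE.
have size_e C : size (e C) = #|T| by rewrite size_cat -!cardE cardsC.
(* The default [x] is never returned: both lists have length [#|T|]. *)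
pose f x := nth x (e B) (index x (e A)).
have lt_index x : (index x (e A) < size (e B))%N.
  by rewrite size_e -(size_e A) index_mem.
have inj_f : injective f.
  move=> x y; rewrite /f (set_nth_default y) // => /eqP.
  by rewrite nth_uniq // => /eqP /index_inj; apply.
exists (perm inj_f); apply/eqP.
rewrite eqEcard card_imset ?eqAB ?leqnn ?andbT; last exact: perm_inj.
apply/subsetP => _ /imsetP[x xA ->].
have lt_x : (index x (enum A) < #|B|)%N by rewrite -eqAB cardE index_mem mem_enum.
rewrite permE /f index_cat mem_enum xA nth_cat -cardE lt_x.
by rewrite -mem_enum mem_nth // -cardE.
Qed.

(** * The core as the largest subformula without pure literals *)

Section Core.
Variable n : nat.
Implicit Types (F G C D : formula n) (l : literal n) (c : clause n).

Lemma nocc_gt0P F l :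
  reflect (exists2 c, c \in F & l \in val c) (0 < nocc F l)%N.
Proof.
apply: (iffP card_gt0P) => [[c] | [c cF lc]].
  by rewrite inE => /andP[]; exists c.
by exists c; rewrite inE cF.
Qed.

Lemma nocc_gt0U F G l :
  (0 < nocc (F :|: G) l)%N = (0 < nocc F l)%N || (0 < nocc G l)%N.
Proof.
apply/nocc_gt0P/orP => [[c /setUP[cF|cG] lc] | [] /nocc_gt0P[c cF lc]].
- by left; apply/nocc_gt0P; exists c.
- by right; apply/nocc_gt0P; exists c.
- by exists c; rewrite // inE cF.
- by exists c; rewrite // inE cF orbT.
Qed.

Lemma nocc_gt0_vars F l : (0 < nocc F l)%N -> l.1 \in vars F.
Proof. by case: l => x [] ?; rewrite inE; apply/orP; [left | right]. Qed.

Definition pure_free F := ~~ [exists l, pure F l].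

Lemma pure_freeP F :
  reflect (forall l, (0 < nocc F l)%N -> (0 < nocc F (neg l))%N) (pure_free F).
Proof.
apply: (iffP existsPn) => [nF l Fl | nF l].
  by have := nF l; rewrite /pure Fl lt0n.
by apply/negP => /andP[/nF]; rewrite lt0n => /negbTE->.
Qed.

(** No run can remove a clause of a subformula without pure literals, so the core contains all such
    subformulas. From here on this maximality replaces the algorithm. *)
Lemma coreP F C :
  reflect [/\ pure_free C, C \subset F &
              forall D, pure_free D -> D \subset F -> D \subset C]
          (core F == C).
Proof.
have /andP[conF freeF] : pla_output F (core F) by rewrite pla_outputE.
have subF := pla_connect_sub conF.
have maxF D : pure_free D -> D \subset F -> D \subset core F.
  by move=> freeD sDF; apply: pla_connect_stable freeD sDF conF.
apply: (iffP eqP) => [<- // | [freeC sCF maxC]].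
by apply/eqP; rewrite eqEsubset maxC ?maxF.
Qed.

Definition full F := forall l, l.1 \in vars F -> (0 < nocc F l)%N.

Lemma type_at_least_full F :
  (forall x, x \in vars F -> type_at_least F x 1 1) -> full F.
Proof. by move=> tF [x b] /tF /andP[]; case: b. Qed.

Definition clauses_over (V : {set 'I_n}) : formula n :=
  [set c : clause n | [forall l in val c, l.1 \in V]].

Lemma sub_clauses_over_vars F : F \subset clauses_over (vars F).
Proof.
apply/subsetP => c cF; rewrite inE; apply/forall_inP => l lc.
by apply: nocc_gt0_vars; apply/nocc_gt0P; exists c.
Qed.

Lemma pure_free_fullU F G :
  full F -> G \subset clauses_over (vars F) -> pure_free (F :|: G).
Proof.
move=> fullF sG; apply/pure_freeP => l.
rewrite !nocc_gt0U => /orP[/nocc_gt0_vars lV | /nocc_gt0P[c cG lc]].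
  by rewrite fullF.
have := subsetP sG c cG; rewrite inE => /forall_inP /(_ l lc) lV.
by rewrite fullF.
Qed.

(** Over the common variables, [F1] alone supplies both literals. Any other literal, and its
    negation, can occur only in [G], where [F1] and [F2] make no difference. *)
Lemma pure_free_exchange F1 F2 G : full F1 -> vars F1 = vars F2 ->
  pure_free (F2 :|: G) -> pure_free (F1 :|: G).
Proof.
move=> full1 eqV /pure_freeP free2; apply/pure_freeP => l.
have [lV _ | lV] := boolP (l.1 \in vars F1); first by rewrite nocc_gt0U full1.
have [F1l | F1l] := boolP (0 < nocc F1 l)%N.
  by rewrite (nocc_gt0_vars F1l) in lV.
rewrite nocc_gt0U (negbTE F1l) /= => Gl.
have := free2 l; rewrite !nocc_gt0U Gl orbT => /(_ isT) /orP[F2l | ->].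
  by rewrite eqV -[l.1]/(neg l).1 (nocc_gt0_vars F2l) in lV.
by rewrite orbT.
Qed.

(** Adding to [C] all clauses of [F] over its variables creates no pure literal, so by maximality
    these clauses were already in [C]. *)
Lemma core_clauses_over F C : full C -> core F == C ->
  F :&: clauses_over (vars C) = C.
Proof.
move=> fullC /coreP[_ sCF maxC]; apply/eqP; rewrite eqEsubset.
rewrite subsetI sCF sub_clauses_over_vars !andbT.
apply: subset_trans (subsetUr C _) (maxC _ _ _).
  by apply: pure_free_fullU; rewrite ?subsetIr.
by rewrite subUset sCF subsetIl.
Qed.

Lemma core_exchange F1 F2 G : full F1 -> full F2 -> vars F1 = vars F2 ->
  [disjoint G & clauses_over (vars F1)] ->
  core (F1 :|: G) == F1 -> core (F2 :|: G) == F2.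
Proof.
move=> full1 full2 eqV disG /coreP[_ _ max1]; apply/coreP; split.
- by rewrite -[F2]setU0; apply: pure_free_fullU; rewrite ?sub0set.
- exact: subsetUl.
move=> D freeD sD.
(* To get [D \subset F2], show that the part of [D] coming from [G] is empty: carried over to [F1],
   it is absorbed by the core [F1]. *)
pose E : formula n := D :&: G.
have defDE : F2 :|: E = F2 :|: D.
  apply/setP => c; rewrite !inE; case: (boolP (c \in D)) => //= cD.
  by have := subsetP sD c cD; rewrite inE orbT.
have freeE : pure_free (F2 :|: E).
  rewrite defDE; apply/pure_freeP => l.
  rewrite !nocc_gt0U => /orP[/nocc_gt0_vars lV | Dl].
    by rewrite full2.
  by rewrite (pure_freeP _ freeD) ?orbT.
have sE1 : E \subset F1.
  apply: subset_trans (subsetUr F1 E) (max1 _ _ _).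
    exact: pure_free_exchange freeE.
  by rewrite setUS ?subsetIr.
(* Clauses of [F1] are over [vars F1], whereas [G] has no such clause. *)
have E0 : E = set0.
  apply/eqP; rewrite -subset0; apply/subsetP => c cE.
  have := disjointFr disG (subsetP (subsetIr D G) c cE).
  by rewrite (subsetP (sub_clauses_over_vars F1)) ?(subsetP sE1).
by rewrite -[F2]setU0 -E0 defDE subsetUr.
Qed.

End Core.

(** * Invariance under permutations of the variables *)

Section Renaming.
Variables (n : nat) (s : {perm 'I_n}).
Implicit Types (F G : formula n) (l : literal n) (c : clause n).

Definition rename_lit l : literal n := (s l.1, l.2).

Lemma rename_lit_inj : injective rename_lit.
Proof. by move=> [x a] [y b] [/perm_inj-> ->]. Qed.

Lemma rename_clause_subproof c : is_clause (rename_lit @: val c).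
Proof.
have /existsP[y /existsP[z /andP[nyz /eqP->]]] := valP c.
apply/existsP; exists (rename_lit y); apply/existsP; exists (rename_lit z).
by rewrite (inj_eq perm_inj) nyz imsetU !imset_set1 eqxx.
Qed.

Definition rename_clause c : clause n := Sub _ (rename_clause_subproof c).

Lemma rename_clause_inj : injective rename_clause.
Proof.
by move=> c d /(congr1 val) /= /(imset_inj rename_lit_inj) /val_inj.
Qed.

Definition rename F : formula n := rename_clause @: F.

Lemma rename_inj : injective rename.
Proof. exact: imset_inj rename_clause_inj. Qed.

Lemma card_rename F : #|rename F| = #|F|.
Proof. exact: card_imset rename_clause_inj. Qed.

Lemma nocc_rename F l : nocc (rename F) (rename_lit l) = nocc F l.
Proof.
rewrite /nocc -[RHS](card_imset _ rename_clause_inj); apply: eq_card => d.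
apply/idP/imsetP => [/[!inE] /andP[/imsetP[c cF ->]] | [c]].
  by rewrite /= mem_imset; [exists c; rewrite ?inE ?cF | exact: rename_lit_inj].
by rewrite inE => /andP[cF lc] ->; rewrite inE /= !imset_f.
Qed.

Lemma vars_rename F : vars (rename F) = s @: vars F.
Proof.
apply/setP => y; rewrite -[y](permKV s) mem_imset; last exact: perm_inj.
set x := (s^-1)%g y.
by rewrite !inE -(nocc_rename F (x, true)) -(nocc_rename F (x, false)).
Qed.

Lemma full_rename F : full F -> full (rename F).
Proof.
move=> fullF [y b]; rewrite vars_rename => /imsetP[x xF /= ->].
by rewrite -[(s x, b)]/(rename_lit (x, b)) nocc_rename fullF.
Qed.

Lemma pure_free_rename F : pure_free (rename F) = pure_free F.
Proof.
apply/pure_freeP/pure_freeP => freeF l.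
  by have := freeF (rename_lit l); rewrite -[neg _]/(rename_lit (neg l)) !nocc_rename.
have -> : l = rename_lit ((s^-1)%g l.1, l.2) by rewrite /rename_lit permKV; case: l.
by rewrite -[neg _]/(rename_lit (neg _)) !nocc_rename; apply: freeF.
Qed.

Lemma rename_subset F G : (rename F \subset rename G) = (F \subset G).
Proof.
apply/idP/idP => [/subsetP sFG | ]; last exact: imsetS.
apply/subsetP => c cF; rewrite -(mem_imset _ _ rename_clause_inj).
by rewrite sFG ?imset_f.
Qed.

Lemma core_rename F C : (core (rename F) == rename C) = (core F == C).
Proof.
(* Maximality quantifies over all formulas [D]; surjectivity of [rename] lets each be written as a
   renamed one. *)
have [r _ renameK] := injF_bij rename_inj.
apply/coreP/coreP; rewrite pure_free_rename rename_subset => -[freeC sC maxC].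
  split=> // D freeD sD.
  by rewrite -rename_subset maxC ?pure_free_rename ?rename_subset.
split=> // D; rewrite -(renameK D) pure_free_rename !rename_subset.
exact: maxC.
Qed.

End Renaming.

(** * Transfer to probabilities *)

Section Probability.
Variables (R : realFieldType) (n : nat) (p : R).
Implicit Types (F G C : formula n).

Lemma rf_weight_card F :
  rf_weight p F = p ^+ #|F| * (1 - p) ^+ (#|clause n| - #|F|).
Proof.
rewrite /rf_weight (bigID (mem F)) /=; congr (_ * _).
  by rewrite -prodr_const; apply: eq_bigr => c ->.
rewrite -cardsT -cardsDS ?subsetT // setTD -prodr_const.
by apply: eq_big => c; rewrite ?inE // => /negbTE->.
Qed.

Lemma eq_card_rf_weight F G : #|F| = #|G| -> rf_weight p F = rf_weight p G.
Proof. by rewrite !rf_weight_card => ->. Qed.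

Lemma Pr_core_rename (s : {perm 'I_n}) C :
  Pr p (fun F => core F == rename s C) = Pr p (fun F => core F == C).
Proof.
rewrite /Pr (reindex_inj (@rename_inj n s)); apply: eq_big => F.
  exact: core_rename.
by move=> _; apply/eq_card_rf_weight/card_rename.
Qed.

Lemma Pr_core_eq_vars F1 F2 : full F1 -> full F2 -> vars F1 = vars F2 ->
  #|F1| = #|F2| ->
  Pr p (fun F => core F == F1) = Pr p (fun F => core F == F2).
Proof.
move=> full1 full2 eqV eqC; set W := clauses_over (vars F1).
have sF1 : F1 \subset W by apply: sub_clauses_over_vars.
have sF2 : F2 \subset W by rewrite /W eqV sub_clauses_over_vars.
(* [h C F] replaces the clauses of [F] over the common variables by [C]; [h F1] and [h F2] are
   mutually inverse between the two events. *)
pose h C F := C :|: F :\: W.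
have hh C D F : C \subset W -> h D (h C F) = h D F.
  move=> sC; rewrite /h setDUl; have /eqP-> : C :\: W == set0.
    by rewrite setD_eq0.
  by rewrite set0U setDDl setUid.
have hcore C F : full C -> vars C = vars F1 -> core F == C -> h C F = F.
  move=> fullC eqVC /(core_clauses_over fullC); rewrite eqVC -/W /h => {1}<-.
  exact: setID.
have disW F : [disjoint F :\: W & W] by rewrite -setI_eq0 setIDAC setDIl setDv setI0.
rewrite /Pr (reindex_onto (h F1) (h F2)) => [|F cF]; last first.
  by rewrite hh // hcore.
(* The second conjunct, left by the reindexing, says that the clauses of [F] in [W] are exactly
   those of [F2]. *)
have eqE F : (core (h F1 F) == F1) && (h F2 (h F1 F) == F) = (core F == F2).
  rewrite hh //; apply/andP/idP => [[c1 /eqP <-] | c2].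
    by apply: core_exchange c1; rewrite // -/W.
  have h2 : h F2 F = F by rewrite hcore.
  rewrite h2; split=> //; rewrite -h2 in c2.
  by apply: core_exchange c2; rewrite // -eqV -/W.
apply: eq_big => [F | F]; first exact: eqE.
rewrite eqE => c2; apply: eq_card_rf_weight.
rewrite -[in RHS](hcore F2 F) // /h !cardsU eqC.
have disj C : C \subset W -> C :&: (F :\: W) = set0.
  move=> sC; apply/eqP; rewrite setI_eq0 disjoint_sym.
  exact: disjointWr sC (disW F).
by rewrite !disj.
Qed.

End Probability.

Theorem theorem1p3 (R : realFieldType) (n : nat) (p : R)
    (hp : 0 <= p <= 1) (F1 F2 : formula n)
    (hclauses : #|F1| = #|F2|)
    (hvars : #|vars F1| = #|vars F2|)
    (htype1 : forall x : 'I_n, x \in vars F1 -> type_at_least F1 x 1 1)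
    (htype2 : forall x : 'I_n, x \in vars F2 -> type_at_least F2 x 1 1) :
  Pr p (fun F : formula n => core F == F1)
  = Pr p (fun F : formula n => core F == F2).
Proof.
(* Renaming [F1] along [s] preserves its probability of being the core and reduces to equal variable
   sets. *)
have [s sV] := perm_imset_eq_card hvars.
rewrite -(Pr_core_rename p s); apply: Pr_core_eq_vars.
- exact/full_rename/type_at_least_full.
- exact: type_at_least_full.
- by rewrite vars_rename.
- by rewrite card_rename.
Qed.
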